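(* Let $d\ge 2$, $n\ge 3$, and let $H$ be a two-dimensional subspace of $\mathbb R^d$ with orthonormal basis $\{u,v\}$. Define $p:[n]\to\mathbb R^d$ by \[ p(k)=\cos\frac{2(k-1)\pi}{n}\,u+\sin\frac{2(k-1)\pi}{n}\,v,\qquad 1\le k\le n. \] Then the spectrum of the stiffness matrix $L(K_n,p)$ is \[ \operatorname{Spec}(L(K_n,p))=\left\{n^{(1)},\ \left(\frac n2\right)^{(2n-4)},\ 0^{(n(d-2)+3)}\right\}, \] where superscripts denote algebraic multiplicities.
   Context: Here $[n]=\{1,\dots,n\}$ is the vertex set of the complete graph $K_n$, and $\|\cdot\|$ is the Euclidean norm. For $p:[n]\to\mathbb R^d$ and $1\le i<j\le n$ let \[ d_{ij}=\frac{p(i)-p(j)}{\|p(i)-p(j)\|}\ \text{ if } p(i)\ne p(j),\qquad d_{ij}=0\ \text{ if } p(i)=p(j). \] Let $1_1,\dots,1_n$ be the standard basis of $\mathbb R^n$ and let $\mathbf v_{ij}=(1_i-1_j)\otimes d_{ij}\in\mathbb R^{dn}$ (Kronecker product). The normalized rigidity matrix $R(K_n,p)$ is the $dn\times\binom n2$ matrix whose columns are the vectors $\mathbf v_{ij}$, $1\le i<j\le n$. The stiffness matrix is $L(K_n,p)=R(K_n,p)R(K_n,p)^T$, a real symmetric positive semidefinite $dn\times dn$ matrix. *)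

(* Defs.v *)
(* The vertex set {1, ..., n} of K_n is 'I_n: vertex k is the ordinal k - 1. *)
From HB Require Import structures.
From mathcomp Require Import all_boot all_order all_algebra.
From mathcomp Require Export mxtens.
From mathcomp Require Export boolp reals trigo.

Set Implicit Arguments.
Unset Strict Implicit.
Unset Printing Implicit Defensive.

Import Order.TTheory GRing.Theory Num.Theory.
Local Open Scope ring_scope.

Definition dot (R : realType) (d : nat) (x y : 'cV[R]_d) : R :=
  \sum_(i < d) x i 0 * y i 0.

(* The norm `|x| that MathComp-Analysis puts on matrices is the sup norm, so
   the Euclidean norm is defined separately. *)
Definition enorm (R : realType) (d : nat) (x : 'cV[R]_d) : R :=
  Num.sqrt (dot x x).

Definition orthonormal_basis (R : realType) (d : nat)
    (H : {vspace 'cV[R]_d}) (u v : 'cV[R]_d) : Prop :=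
  [/\ basis_of H [:: u; v], enorm u = 1, enorm v = 1 & dot u v = 0].

Definition direction (R : realType) (n d : nat) (p : 'I_n -> 'cV[R]_d)
    (i j : 'I_n) : 'cV[R]_d :=
  if p i == p j then 0 else (enorm (p i - p j))^-1 *: (p i - p j).

(* delta_mx i 0 is the standard basis vector 1_i; the Kronecker product *t of
   column vectors has shape (n * d) x (1 * 1), which is convertible to
   (n * d) x 1. *)
Definition edge_vector (R : realType) (n d : nat) (p : 'I_n -> 'cV[R]_d)
    (i j : 'I_n) : 'cV[R]_(n * d) :=
  ((delta_mx i 0 - delta_mx j 0 : 'cV[R]_n) *t direction p i j).

Definition edges (n : nat) : {set 'I_n * 'I_n} :=
  [set ij : 'I_n * 'I_n | (ij.1 < ij.2)%N].

Lemma card_edges (n : nat) : #|edges n| = 'C(n, 2).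
Proof.
rewrite -bin2_sum big_mkord -sum1_card.
rewrite (eq_bigl (fun ij : 'I_n * 'I_n => true && (ij.1 < ij.2)%N)); last first.
  by move=> ij; rewrite inE.
rewrite -(pair_big_dep xpredT (fun i j : 'I_n => (i < j)%N) (fun _ _ => 1%N)) /=.
rewrite (exchange_big_dep xpredT) //=; apply: eq_bigr => j _.
by rewrite -(big_ord_widen n (fun=> 1%N) (ltnW (ltn_ord j))) sum1_card card_ord.
Qed.

(* The columns are enumerated by enum_val, i.e., in the (arbitrary but fixed)
   order of enum (edges n). *)
Definition rigidity_mx (R : realType) (n d : nat) (p : 'I_n -> 'cV[R]_d) :
    'M[R]_(n * d, #|edges n|) :=
  \matrix_(r, e) edge_vector p (enum_val e).1 (enum_val e).2 r 0.

Definition stiffness_mx (R : realType) (n d : nat) (p : 'I_n -> 'cV[R]_d) :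
    'M[R]_(n * d) :=
  rigidity_mx p *m (rigidity_mx p)^T.

(* s lists all the eigenvalues of A, each one repeated according to its
   algebraic multiplicity, i.e., its multiplicity as a root of char_poly A. *)
Definition has_spectrum (R : realType) (m : nat) (A : 'M[R]_m) (s : seq R) :
    Prop :=
  char_poly A = \prod_(x <- s) ('X - x%:P).

(* Main.v *)
(* With [U] the matrix of columns [u], [v], [rot] the plane rotation and [refl]
   the reflection in the first axis, the direction between the points of angles
   [a] and [b] spans the projection [U (1 - rot (a + b) refl) U^T / 2]. The right
   factor of [rot (a + b) refl = rot a refl (rot b)^T] depends on [b] only and the
   sum of all the rotations vanishes, so the stiffness matrix is
   [Q (n/2 + F S F^T) Q^T] where [Q = 1 (x) U] is an isometry, [F] has [n] block
   rows [(1, rot a_i)], [F^T F = n] and [S = diag (-1, -1, 1, -1) / 2]. Exchanging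
   the factors of a matrix product in characteristic polynomials reduces the
   spectrum to that of the 4 x 4 matrix [n/2 + n S]. *)
Require Import Defs.
From mathcomp Require Import all_boot all_order all_algebra.
From mathcomp Require Import boolp reals trigo.
From mathcomp Require Import ring lra zify.

Import Order.TTheory GRing.Theory Num.Theory.
Local Open Scope ring_scope.

(** * Exchanging the factors of a product in characteristic polynomials *)

(** Sylvester's identity, kept free of division by the powers of [x]. Both sides equal
    [x ^+ n * \det M]: a factorization of [M] exposes [A *m B], and a lower triangular left factor
    clears [B] and exposes [B *m A]. *)
Lemma det_scalar_sub_mulmxC {R : comNzRingType} {m n : nat} (x : R)
    (A : 'M[R]_(m, n)) (B : 'M[R]_(n, m)) :
  x ^+ n * \det (x%:M - A *m B) = x ^+ m * \det (x%:M - B *m A).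
Proof.
pose M := block_mx (x%:M : 'M_m) A B (1%:M : 'M_n).
have dA : \det M = \det (x%:M - A *m B).
  have -> : M = block_mx (x%:M - A *m B) A 0 1%:M *m block_mx 1%:M 0 B 1%:M.
    rewrite mulmx_block !mulmx0 !mul0mx !mulmx1 ?mul1mx !add0r subrK.
    by rewrite /M.
  by rewrite det_mulmx det_ublock det_lblock !det1 !mulr1.
have : \det (block_mx (1%:M : 'M_m) 0 (- B) x%:M *m M) = x ^+ m * \det (x%:M - B *m A).
  rewrite mulmx_block !mul0mx !mul1mx !addr0 mulmx1 mulNmx scalar_mxC.
  by rewrite addNr det_ublock det_scalar addrC mulNmx.
by rewrite det_mulmx det_lblock det1 det_scalar mul1r dA.
Qed.

Lemma char_poly_isometry {R : comNzRingType} {m n : nat}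
    (Q : 'M[R]_(m, n)) (K : 'M[R]_n) :
  Q^T *m Q = 1%:M -> 'X^n * char_poly (Q *m K *m Q^T) = 'X^m * char_poly K.
Proof.
move=> QQ; rewrite /char_poly /char_poly_mx [X in _%:M - X]map_mxM.
by rewrite det_scalar_sub_mulmxC -map_mxM mulmxA QQ mul1mx.
Qed.

(** The scalar [c] joins the indeterminate: the exchange is used at ['X - c%:P]. *)
Lemma char_poly_scalar_add_mulmx {R : comNzRingType} {m n : nat} (c : R)
    (A : 'M[R]_(m, n)) (B : 'M[R]_(n, m)) :
  ('X - c%:P) ^+ n * char_poly (c%:M + A *m B) =
  ('X - c%:P) ^+ m * \det (('X - c%:P)%:M - map_mx polyC (B *m A)).
Proof.
rewrite map_mxM -det_scalar_sub_mulmxC -map_mxM /char_poly /char_poly_mx.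
by rewrite map_mxD map_scalar_mx opprD addrA raddfB.
Qed.

(** * Block columns *)

(** Rows are numbered as in a Kronecker product, so that blocks can be compared through
    [mxtens_index]. *)
Definition stack_mx {R : nmodType} {n p q : nat} (f : 'I_n -> 'M[R]_(p, q)) :
    'M[R]_(n * p, q) :=
  \matrix_(r, s) f (mxtens_unindex r).1 (mxtens_unindex r).2 s.

Lemma mul_stack_mx {R : pzRingType} {n p q s : nat}
    (f : 'I_n -> 'M[R]_(p, q)) (A : 'M[R]_(q, s)) :
  stack_mx f *m A = stack_mx (fun i => f i *m A).
Proof.
by apply/matrixP => r t; rewrite !mxE; apply: eq_bigr => k _; rewrite mxE.
Qed.

Lemma mul_stack_mx_trE {R : pzRingType} {n p q : nat}
    (f g : 'I_n -> 'M[R]_(p, q)) i j a b :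
  (stack_mx f *m (stack_mx g)^T) (mxtens_index (i, a)) (mxtens_index (j, b)) =
  (f i *m (g j)^T) a b.
Proof.
by rewrite !mxE; apply: eq_bigr => k _; rewrite !mxE !mxtens_indexK.
Qed.

Lemma tr_stack_mx_mul {R : pzRingType} {n p q s : nat}
    (f : 'I_n -> 'M[R]_(p, q)) (g : 'I_n -> 'M[R]_(p, s)) :
  (stack_mx f)^T *m stack_mx g = \sum_i (f i)^T *m g i.
Proof.
apply/matrixP => a b; rewrite summxE mxE.
under [RHS]eq_bigr do rewrite mxE.
rewrite (reindex (@mxtens_index n p)) /=; last first.
  by exists (@mxtens_unindex n p) => ? _; rewrite (mxtens_indexK, mxtens_unindexK).
rewrite pair_big /=; apply: eq_bigr => -[i c] _.
by rewrite !mxE mxtens_indexK.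
Qed.

(** * Sums over edges and weighted Laplacians *)

Lemma sum_pairs_lt {V : nmodType} {n : nat} (g : 'I_n -> 'I_n -> V) :
    (forall k l, g k l = g l k) -> (forall k, g k k = 0) ->
  \sum_k \sum_l g k l = (\sum_(kl in edges n) g kl.1 kl.2) *+ 2.
Proof.
move=> gC g0; rewrite pair_big /= (bigID (mem (edges n))) /= mulr2n.
congr (_ + _); rewrite (bigID (fun kl : 'I_n * 'I_n => kl.1 == kl.2)) /=.
rewrite big1 ?add0r => [|[k l] /= /andP[_ /eqP->]]; last exact: g0.
rewrite (reindex_inj (_ : injective (fun kl : 'I_n * 'I_n => (kl.2, kl.1)))) /=; last first.
  by move=> [k l] [k' l'] [-> ->].
apply: eq_big => [[k l]|[k l] _] /=; last exact: gC.
by rewrite !inE /= -leqNgt andbC eq_sym -val_eqE /= ltn_neqAle.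
Qed.

(** An entry of the Laplacian of the complete graph with weights [f]. The summand is symmetric and
    vanishes for [k = l], so twice the sum runs over all ordered pairs, where the deltas collapse.
    On the right [f i i] cancels when [i = j], so the diagonal of [f] is free. *)
Lemma sum_weighted_laplacian {F : numFieldType} {n : nat}
    (f : 'I_n -> 'I_n -> F) (i j : 'I_n) :
    (forall k l, f k l = f l k) ->
  \sum_(kl in edges n) ((i == kl.1)%:R - (i == kl.2)%:R) *
     ((j == kl.1)%:R - (j == kl.2)%:R) * f kl.1 kl.2 =
  (i == j)%:R * (\sum_l f i l) - f i j.
Proof.
move=> fC.
pose g (k l : 'I_n) : F :=
  ((i == k)%:R - (i == l)%:R) * ((j == k)%:R - (j == l)%:R) * f k l.
have delta_sum (h : 'I_n -> F) k : \sum_l (k == l)%:R * h l = h k.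
  rewrite (bigD1 k) //= eqxx mul1r big1 ?addr0 // => l /negPf.
  by rewrite eq_sym => ->; rewrite mul0r.
have two0 : (2 : F) != 0 by rewrite pnatr_eq0.
apply: (mulIf two0); rewrite ![_ * 2]mulr_natr -(@sum_pairs_lt _ _ g); first last.
- by move=> k; rewrite /g subrr !mul0r.
- by move=> k l; rewrite /g fC; ring.
transitivity (\sum_k \sum_l ((i == k)%:R * ((j == k)%:R * f k l) +
   (i == l)%:R * ((j == l)%:R * f k l) - (i == k)%:R * ((j == l)%:R * f k l)
   - (j == k)%:R * ((i == l)%:R * f k l))).
  by apply: eq_bigr => k _; apply: eq_bigr => l _; rewrite /g; ring.
transitivity (\sum_k ((i == k)%:R * ((j == k)%:R * \sum_l f k l) +
    (j == i)%:R * f k i - (i == k)%:R * f k j - (j == k)%:R * f k i)).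
  apply: eq_bigr => k _; rewrite !sumrB big_split /= delta_sum -!mulr_sumr.
  by rewrite !delta_sum.
rewrite !sumrB big_split /= !delta_sum -mulr_sumr (fC j i) eq_sym.
under [X in _ + _ * X]eq_bigr do rewrite fC.
by rewrite mulr2n; ring.
Qed.

(** * Plane rotations and sums over equally spaced angles *)

Section Trigonometry.
Context {R : realType}.
Implicit Types a b : R.

Definition rotation a : 'M[R]_(1 + 1) :=
  block_mx (cos a)%:M (- sin a)%:M (sin a)%:M (cos a)%:M.

Definition reflection : 'M[R]_(1 + 1) := block_mx 1%:M 0 0 (- 1)%:M.

Lemma rotationD a b : rotation a *m rotation b = rotation (a + b).
Proof.
rewrite /rotation mulmx_block -!scalar_mxM -!raddfD /= cosD sinD.
by congr block_mx; congr _%:M; ring.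
Qed.

Lemma rotation0 : rotation 0 = 1%:M.
Proof. by rewrite /rotation cos0 sin0 oppr0 (raddf0 scalar_mx) -scalar_mx_block. Qed.

Lemma tr_rotation a : (rotation a)^T = rotation (- a).
Proof. by rewrite /rotation tr_block_mx !tr_scalar_mx cosN sinN opprK. Qed.

Lemma reflection_rotation a : reflection *m rotation a = rotation (- a) *m reflection.
Proof.
rewrite /rotation /reflection !mulmx_block !mulmx0 !mul0mx !addr0 !add0r cosN sinN.
by rewrite -!scalar_mxM !(mulrN1, mulN1r, mulr1, mul1r, opprK).
Qed.

Lemma tr_rotation_mul a : (rotation a)^T *m rotation a = 1%:M.
Proof. by rewrite tr_rotation rotationD addNr rotation0. Qed.

(** By the double angle formula [cos a = 1] forces [sin (|a| / 2) = 0], impossible strictly between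
    [0] and [pi]. *)
Lemma cos_neq1 a : a != 0 -> `|a| < 2 * pi -> cos a != 1.
Proof.
move=> a0 a2pi; apply/eqP => ca.
have: 0 < sin (`|a| / 2).
  apply: sin_gt0_pi; rewrite divr_gt0 ?normr_gt0 //=.
  by rewrite ltr_pdivrMr // mulrC.
suff -> : sin (`|a| / 2) = 0 by rewrite ltxx.
have: cos (`|a| / 2 *+ 2) = 1 by rewrite -[_ *+ 2]mulr_natr divfK ?pnatr_eq0 // cos_norm.
rewrite cos_mulr2n cos2sin2 => e.
apply/eqP; rewrite -sqrf_eq0; apply/eqP; lra.
Qed.

(** The index is a [nat], not an ordinal, so that telescoping can reach the full turn
    [angle n n]. *)
Definition angle (n k : nat) : R := 2 * k%:R * pi / n%:R.

Lemma cos_angleB_neq1 {n : nat} {i j : 'I_n} :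
  i != j -> cos (angle n i - angle n j) != 1.
Proof.
move=> ij; have n0 : 0 < n%:R :> R by rewrite ltr0n (leq_ltn_trans _ (ltn_ord i)).
have -> : angle n i - angle n j = 2 * pi / n%:R * (i%:R - j%:R).
  by rewrite /angle; field; rewrite lt0r_neq0.
have c0 : 0 < 2 * pi / n%:R :> R by rewrite divr_gt0 // mulr_gt0 // pi_gt0.
apply: cos_neq1; first by rewrite mulf_neq0 ?(lt0r_neq0 c0) // subr_eq0 eqr_nat.
rewrite normrM (gtr0_norm c0) -[ltRHS](divfK (lt0r_neq0 n0)) ltr_pM2l //.
have := ltn_ord i; have := ltn_ord j; rewrite -!(ltr_nat R) => jn iN.
have := ler0n R i; have := ler0n R j => j0 i0.
by rewrite ltr_norml; apply/andP; split; lra.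
Qed.

(* Multiplied by [2 * sin (pi / n)], the sum telescopes. *)
Lemma sum_cos_angle {n : nat} a : (2 <= n)%N -> \sum_(k < n) cos (a + angle n k) = 0.
Proof.
move=> n2; have n0 : 0 < n%:R :> R by rewrite ltr0n (ltn_trans _ n2).
have s0 : 0 < sin (pi / n%:R) :> R.
  apply: sin_gt0_pi; rewrite divr_gt0 ?pi_gt0 //= ltr_pdivrMr //.
  by rewrite ltr_pMr ?pi_gt0 // ltr1n.
apply: (mulfI (lt0r_neq0 s0)); apply: (mulfI (_ : (2 : R) != 0)); first by rewrite pnatr_eq0.
rewrite !mulr0 !mulr_sumr.
pose f k : R := sin (a + angle n k - pi / n%:R).
transitivity (\sum_(0 <= k < n) (f k.+1 - f k)).
  rewrite big_mkord; apply: eq_bigr => k _; rewrite /f.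
  have -> : a + angle n k.+1 - pi / n%:R = a + angle n k + pi / n%:R.
    by rewrite /angle -natr1; field; rewrite lt0r_neq0.
  by rewrite sinB sinD; ring.
rewrite telescope_sumr // /f.
have -> : a + angle n n - pi / n%:R = a + angle n 0 - pi / n%:R + pi *+ 2.
  by rewrite /angle mulr2n; field; rewrite lt0r_neq0.
by rewrite sinD2pi subrr.
Qed.

Lemma sum_sin_angle {n : nat} a : (2 <= n)%N -> \sum_(k < n) sin (a + angle n k) = 0.
Proof.
move=> n2; rewrite -[RHS](sum_cos_angle (a - pi / 2) n2); apply: eq_bigr => k _.
by rewrite addrAC cosBpihalf.
Qed.

(** The offset [a] is [0] in [tr_frame_mul] and the angle of a vertex in [stiffness_circle]. *)
Lemma sum_rotation_angle {n : nat} a :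
  (2 <= n)%N -> \sum_(k < n) rotation (a + angle n k) = 0.
Proof.
move=> n2.
have rotE b : rotation b =
    cos b *: 1%:M + sin b *: block_mx 0 (- 1)%:M 1%:M 0 :> 'M[R]_(1 + 1).
  rewrite (scalar_mx_block 1 1) !scale_block_mx add_block_mx !scaler0 !addr0 !add0r.
  by rewrite !scale_scalar_mx mulrN !mulr1.
under eq_bigr do rewrite rotE.
by rewrite big_split /= -!scaler_suml sum_cos_angle // sum_sin_angle // !scale0r addr0.
Qed.

End Trigonometry.

(* The chord between two points of the circle is orthogonal to the bisector of
   their angles, so projecting on it is reflecting and averaging. *)
Lemma chord_projection {R : realType} (a b : R) :
  let w := rotation a *m col_mx 1%:M 0 - rotation b *m col_mx 1%:M 0 : 'cV_(1 + 1) in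
  w *m w^T = (1 - cos (a - b)) *: (1%:M - rotation (a + b) *m reflection).
Proof.
move=> w; have -> : w = col_mx (cos a - cos b)%:M (sin a - sin b)%:M.
  rewrite /w /rotation !mul_block_col !mulmx0 !mulmx1 !addr0 opp_col_mx add_col_mx.
  by rewrite !raddfB.
rewrite tr_col_mx !tr_scalar_mx mul_col_row /rotation /reflection mulmx_block.
rewrite !mulmx0 !addr0 !add0r (scalar_mx_block 1 1) opp_block_mx add_block_mx.
rewrite scale_block_mx !mulmx1 -!scalar_mxM !sub0r -!(raddfN scalar_mx) -!(raddfD scalar_mx) !scale_scalar_mx /=.
have ca := cos2sin2 a; have cb := cos2sin2 b.
by rewrite cosB cosD sinD; congr block_mx; congr _%:M; ring: ca cb.
Qed.

(** * Outer products of edge directions *)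

Lemma stiffness_mxE {R : realType} {n d : nat} (p : 'I_n -> 'cV[R]_d) :
  stiffness_mx p =
  \sum_(kl in edges n) edge_vector p kl.1 kl.2 *m (edge_vector p kl.1 kl.2)^T.
Proof.
apply/matrixP => r c; rewrite summxE big_enum_val mxE; apply: eq_bigr => e _.
by rewrite !mxE big_ord1 !mxE.
Qed.

Lemma edge_vector_mul_tr {R : realType} {n d : nat} (p : 'I_n -> 'cV[R]_d) k l :
  let e : 'cV[R]_n := delta_mx k 0 - delta_mx l 0 in
  edge_vector p k l *m (edge_vector p k l)^T =
  (e *m e^T) *t (direction p k l *m (direction p k l)^T).
Proof.
apply/matrixP => r c; rewrite !mxE !big_ord1 !mxE !(ord1 (Ordinal _)) /=; ring.
Qed.

(** The trace is the squared norm, so no square root remains. Coincident points fit as well, since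
    then [x *m x^T = 0]. *)
Lemma direction_mul_tr {R : realType} {n d : nat} (p : 'I_n -> 'cV[R]_d) k l :
  let x := p k - p l in
  direction p k l *m (direction p k l)^T = (\tr (x *m x^T))^-1 *: (x *m x^T).
Proof.
move=> x; rewrite /direction; case: eqP => [pkl|_].
  by rewrite /x pkl subrr !mul0mx scaler0.
rewrite [(_ *: _)^T]linearZ -scalemxAl -scalemxAr scalerA -invfM -expr2 sqr_sqrtr; last first.
  by apply: sumr_ge0 => i _; rewrite -expr2 sqr_ge0.
by congr (_^-1 *: _); apply: eq_bigr => i _; rewrite !mxE big_ord1 !mxE.
Qed.

Lemma direction_circle {R : realType} {n d : nat} (U : 'M[R]_(d, 1 + 1))
    (p : 'I_n -> 'cV[R]_d) (k l : 'I_n) :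
    U^T *m U = 1%:M -> (forall i, p i = U *m (rotation (angle n i) *m col_mx 1%:M 0)) ->
    k != l ->
  direction p k l *m (direction p k l)^T =
  U *m (2^-1 *: (1%:M - rotation (angle n k + angle n l) *m reflection)) *m U^T.
Proof.
move=> UU pE kl; rewrite direction_mul_tr !pE -mulmxBr trmx_mul.
set w := (_ *m _ - _); set A := _ - _ *m reflection.
have -> : U *m w *m (w^T *m U^T) =
    (1 - cos (angle n k - angle n l)) *: (U *m A *m U^T).
  by rewrite mulmxA -(mulmxA U w) chord_projection -scalemxAr -scalemxAl.
have c0 : 1 - cos (angle n k - angle n l) != 0 :> R.
  by rewrite subr_eq0 eq_sym cos_angleB_neq1.
(* A rotation times [reflection] has trace zero, so only the trace of the identity counts, and
   normalizing cancels the chord length. *)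
have -> : \tr ((1 - cos (angle n k - angle n l)) *: (U *m A *m U^T)) =
    (1 - cos (angle n k - angle n l)) * 2.
  rewrite mxtraceZ mxtrace_mulC mulmxA UU mul1mx; congr (_ * _).
  rewrite /A /rotation /reflection mulmx_block !mulmx0 !addr0 !add0r -!scalar_mxM.
  by rewrite raddfB /= mxtrace1 mxtrace_block !mxtrace_scalar; ring.
by rewrite -scalemxAr -scalemxAl scalerA invfM mulrAC mulVf ?mul1r.
Qed.

(** * The stiffness matrix of the regular polygon and its spectrum *)

Definition frame {R : realType} (n : nat) : 'M[R]_(n * (1 + 1), (1 + 1) + (1 + 1)) :=
  stack_mx (fun i : 'I_n => row_mx 1%:M (rotation (angle n i))).

Definition signature {R : realType} : 'M[R]_((1 + 1) + (1 + 1)) :=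
  2^-1 *: block_mx (- 1)%:M 0 0 reflection.

(** The diagonal blocks add up [n] identities, rotations being orthogonal; the other two are the
    vanishing sum of rotations and its transpose. *)
Lemma tr_frame_mul {R : realType} {n : nat} :
  (2 <= n)%N -> (frame n)^T *m frame n = n%:R%:M :> 'M[R]_((1 + 1) + (1 + 1)).
Proof.
move=> n2; rewrite /frame tr_stack_mx_mul.
pose off (Z : 'M[R]_(1 + 1)) := block_mx 0 Z Z^T 0.
transitivity (\sum_(i < n) (1%:M + off (rotation (0 + angle n i)))).
  apply: eq_bigr => i _; rewrite tr_row_mx mul_col_row trmx1 !mul1mx !mulmx1 add0r.
  by rewrite tr_rotation_mul /off (scalar_mx_block 2 2) add_block_mx !add0r !addr0.
have -> : \sum_(i < n) (1%:M + off (rotation (0 + angle n i))) =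
    n%:R%:M + off (\sum_(i < n) rotation (0 + angle n i)).
  rewrite big_split /= sumr_const card_ord -[n%:R%:M]scalemx1 scaler_nat; congr (_ + _).
  apply: (big_ind2 (fun M Z => M = off Z)) => // [|_ Z _ Z' -> ->].
    by rewrite /off trmx0 block_mx0.
  by rewrite /off raddfD add_block_mx !addr0.
by rewrite sum_rotation_angle // /off trmx0 block_mx0 addr0.
Qed.

Lemma frame_signature_mul_trE {R : realType} {n : nat} (i j : 'I_n) a b :
  (frame n *m signature *m (frame n)^T) (mxtens_index (i, a)) (mxtens_index (j, b)) =
  - (2^-1 *: (1%:M - rotation (angle n i + angle n j) *m reflection)) a b :> R.
Proof.
rewrite /frame mul_stack_mx mul_stack_mx_trE.
set T := _ *: _; have -> : - T a b = (- T) a b by rewrite [RHS]mxE.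
congr (_ a b); rewrite /T /signature.
rewrite tr_row_mx trmx1 -scalemxAr -scalemxAl -scalerN.
rewrite mul_row_block !mulmx0 addr0 add0r mul_row_col mulmx1 mul1mx opprB addrC.
rewrite tr_rotation -mulmxA reflection_rotation mulmxA opprK rotationD.
by rewrite (raddfN scalar_mx).
Qed.

Lemma stiffness_circle {R : realType} {n d : nat} (U : 'M[R]_(d, 1 + 1))
    (p : 'I_n -> 'cV[R]_d) :
    (2 <= n)%N -> U^T *m U = 1%:M ->
    (forall i, p i = U *m (rotation (angle n i) *m col_mx 1%:M 0)) ->
  let Q := (1%:M : 'M_n) *t U in
  stiffness_mx p =
  Q *m ((n%:R / 2)%:M + frame n *m signature *m (frame n)^T) *m Q^T.
Proof.
move=> n2 UU pE Q; rewrite stiffness_mxE.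
pose T (k l : 'I_n) : 'M[R]_(1 + 1) :=
  2^-1 *: (1%:M - rotation (angle n k + angle n l) *m reflection).
pose e (k l : 'I_n) : 'cV[R]_n := delta_mx k 0 - delta_mx l 0.
(* Edges have [k != l], so [direction_circle] applies, and the mixed product rule pulls [Q] out of
   each term. *)
transitivity (\sum_(kl in edges n)
    Q *m ((e kl.1 kl.2 *m (e kl.1 kl.2)^T) *t T kl.1 kl.2) *m Q^T).
  apply: eq_bigr => -[k l]; rewrite inE /= => kl.
  rewrite edge_vector_mul_tr (direction_circle U p k l UU pE) ?neq_ltn ?kl // /Q.
  by rewrite trmx_tens !tensmx_mul trmx1 mul1mx mulmx1.
rewrite -mulmx_suml -mulmx_sumr; congr (_ *m _ *m _).
apply/matrixP => r c.
case: (mxtens_indexP r) => i a; case: (mxtens_indexP c) => j b.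
rewrite summxE [RHS]mxE frame_signature_mul_trE -/(T i j).
(* The Laplacian identity is applied entrywise. The values [T k k], which no edge supplies, cancel
   in it, yet they make the subtracted term match the [frame] product on the diagonal blocks too. *)
transitivity ((i == j)%:R * (\sum_l T i l a b) - T i j a b).
  rewrite -(sum_weighted_laplacian (fun k l => T k l a b)) => [|k l]; last by rewrite /T (addrC (angle n k)).
  apply: eq_bigr => -[k l] _; rewrite tensmxE mxE big_ord1 !mxE !eqxx !andbT.
  by [].
(* Summed over [l], the rotations vanish and [n / 2] times the identity remains. *)
congr (_ + _); rewrite -summxE /T -scaler_sumr sumrB sumr_const card_ord.
rewrite -mulmx_suml sum_rotation_angle // mul0mx subr0 -scaler_nat !mxE.
rewrite (can_eq (@mxtens_indexK _ _)) xpair_eqE.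
by case: (i == j); case: (a == b) => /=; field.
Qed.

Lemma char_poly_frame {R : realType} {n : nat} :
    (2 <= n)%N ->
  char_poly ((n%:R / 2)%:M + frame n *m signature *m (frame n)^T : 'M[R]_(n * (1 + 1))) =
  ('X - n%:R%:P) * ('X - (n%:R / 2)%:P) ^+ (2 * n - 4) * 'X ^+ 3.
Proof.
move=> n2; set c : R := n%:R / 2; set Y : {poly R} := 'X - c%:P.
have Y0 : Y != 0 by rewrite polyXsubC_eq0.
apply: (mulfI (expf_neq0 4 Y0)).
rewrite -mulmxA (char_poly_scalar_add_mulmx c) -/Y -mulmxA tr_frame_mul //.
have -> : signature *m n%:R%:M = c *: block_mx (- 1)%:M 0 0 reflection :> 'M[R]_(_ + _).
  by rewrite mul_mx_scalar /signature scalerA.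
(* The matrix is diagonal with three entries [Y + c = 'X] and one entry [Y - c = 'X - n]. *)
have -> : \det (Y%:M - map_mx polyC (c *: block_mx ((- 1)%:M : 'M_(1 + 1)) 0 0 reflection)) =
    'X ^+ 3 * ('X - n%:R%:P).
  rewrite map_mxZ map_block_mx !map_mx0 /reflection map_block_mx !map_mx0.
  rewrite !map_scalar_mx rmorphN1 rmorph1 (scalar_mx_block 2 2) !(scalar_mx_block 1 1).
  rewrite !scale_block_mx !scaler0 !opp_block_mx !add_block_mx !oppr0 !addr0.
  rewrite !scale_scalar_mx mulrN !mulr1 -!(raddfN scalar_mx) -!(raddfD scalar_mx) opprK.
  rewrite !det_ublock !det_scalar /Y subrK expr1 -addrA -opprD -polyCD -splitr.
  by ring.
(* The subtraction is exact because [2 <= n]; the four split factors [Y] are those introduced by the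
   exchange. *)
have -> : (n * (1 + 1) = 4 + (2 * n - 4))%N by lia.
by rewrite exprD; ring.
Qed.

Theorem theorem2 (R : realType) (d n : nat) (hd : (2 <= d)%N) (hn : (3 <= n)%N)
    (H : {vspace 'cV[R]_d}) (hH : (\dim H = 2)%N) (u v : 'cV[R]_d)
    (huv : orthonormal_basis H u v) (p : 'I_n -> 'cV[R]_d)
    (hp : forall k : 'I_n,
        p k = cos (2 * k%:R * pi / n%:R) *: u + sin (2 * k%:R * pi / n%:R) *: v) :
  has_spectrum (stiffness_mx p)
    (n%:R :: nseq (2 * n - 4) (n%:R / 2) ++ nseq (n * (d - 2) + 3) 0).
Proof.
have n2 : (2 <= n)%N by exact: ltnW.
pose U : 'M[R]_(d, 1 + 1) := row_mx u v.
have dotE (x y : 'cV[R]_d) : x^T *m y = (dot x y)%:M.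
  by apply/matrixP => a b; rewrite !ord1 !mxE eqxx; apply: eq_bigr => i _; rewrite mxE.
have dotC (x y : 'cV[R]_d) : dot x y = dot y x.
  by apply: eq_bigr => i _; rewrite mulrC.
have enorm1 (x : 'cV[R]_d) : enorm x = 1 -> dot x x = 1.
  move=> x1; rewrite -[LHS]sqr_sqrtr -/(enorm x) ?x1 ?expr1n //.
  by apply: sumr_ge0 => i _; rewrite -expr2 sqr_ge0.
case: huv => _ /enorm1 uu /enorm1 vv uv.
have UU : U^T *m U = 1%:M.
  rewrite tr_row_mx mul_col_row !dotE uu vv uv dotC uv (raddf0 scalar_mx).
  by rewrite -scalar_mx_block.
have pE i : p i = U *m (rotation (angle n i) *m col_mx 1%:M 0).
  rewrite hp /rotation mul_block_col !mulmx0 !mulmx1 !addr0 mul_row_col.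
  by rewrite !mul_mx_scalar.
have QQ : ((1%:M : 'M[R]_n) *t U)^T *m ((1%:M : 'M_n) *t U) = 1%:M.
  rewrite trmx_tens tensmx_mul trmx1 mul1mx UU.
  apply/matrixP => r c; case: (mxtens_indexP r) => i a; case: (mxtens_indexP c) => j b.
  rewrite tensmxE !mxE (can_eq (@mxtens_indexK _ _)) xpair_eqE.
  by rewrite -natrM mulnb.
rewrite /has_spectrum (stiffness_circle U p n2 UU pE).
have X0 : 'X^(n * (1 + 1)) != 0 :> {poly R} by rewrite expf_neq0 // polyX_eq0.
apply: (mulfI X0); rewrite (char_poly_isometry _ _ QQ) char_poly_frame //.
rewrite big_cons big_cat /= !big_nseq !iter_mulr_1 subr0.
(* The [n * (d - 2)] zeros come from the directions orthogonal to the plane; the other three come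
   from [char_poly_frame]. *)
have -> : (n * d = n * (1 + 1) + n * (d - 2))%N by rewrite -mulnDr subnKC.
by rewrite !exprD; ring.
Qed.
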